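(* Suppose (A1) $f(x)\to+\infty$ as $|x|\to\infty$; (A2) $\nabla f(x)\neq 0$ for all $x\in\Omega$; (A3) $\nabla g(x)\neq 0$ for all $x\in\Omega$; (A4) $f$ and $g$ are twice continuously differentiable on $\mathbb{R}^n$. Let $x_0\in\Omega$. Then: (i) for every $\zeta\in[0,1)$, the trajectory $x(t;\zeta,x_0)$ must go out of the feasible set $\Omega$, i.e. there is $t\in[0,T_{\zeta,x_0})$ with $x(t;\zeta,x_0)\notin\Omega$; (ii) there is a constant $C$ independent of $\zeta$ such that, for every $\zeta\in[0,1)$, the minimum time at which the trajectory $x(t;\zeta,x_0)$ reaches the boundary $\{x: g(x)=0\}$ of the feasible set is at most $\frac{C}{1-\zeta}$.
   Context: Let $f,g:\mathbb{R}^n\to\mathbb{R}$ and let $\Omega=\{x\in\mathbb{R}^n: g(x)\le 0\}$ be the feasible set. $|\cdot|$ is the Euclidean norm. For $\zeta\in[0,1)$ define, wherever $\nabla f\ne0$ and $\nabla g\neq 0$, the vector field $\mathbf{s}_\zeta=-\frac{\nabla f}{|\nabla f|}-\zeta\frac{\nabla g}{|\nabla g|}$. For an initial point $x_0\in\Omega$, $x(t;\zeta,x_0)$ denotes the solution of $\frac{dx}{dt}=\mathbf{s}_\zeta(x)$, $x|_{t=0}=x_0$, and $[0,T_{\zeta,x_0})$ is its maximal forward interval of existence in the whole $\mathbb{R}^n$ (that is, not restricted to $\Omega$). *)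

(* Defs.v *)
From HB Require Import structures.
From mathcomp Require Export all_boot all_order all_algebra.
From mathcomp Require Export all_classical all_reals all_analysis.

Set Implicit Arguments.
Unset Strict Implicit.
Unset Printing Implicit Defensive.

Export Order.TTheory GRing.Theory Num.Theory.
Export numFieldNormedType.Exports.

Local Open Scope classical_set_scope.
Local Open Scope ring_scope.

Section Defs.
Context {R : realType} {n : nat}.
Implicit Types (f g : 'rV[R]_n -> R) (u : 'rV[R]_n) (zeta tau : R).
Implicit Types (T : \bar R) (x y : R -> 'rV[R]_n).

(* The library norm `|u| on 'rV[R]_n is the sup norm; it induces the same
   topology and the same differentiability notions as the Euclidean norm. *)
Definition enorm u : R := Num.sqrt (\sum_(i < n) u ord0 i ^+ 2).

Definition grad f u : 'rV[R]_n := \row_(i < n) 'D_(delta_mx ord0 i) f u.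

(* Twice Frechet differentiable everywhere, with a continuous Hessian.
   (Continuity of f and of grad f follows from differentiability.) *)
Definition C2 f : Prop :=
  [/\ forall u, differentiable f u,
      forall u, differentiable (grad f) u &
      continuous (jacobian (grad f))].

Definition coercive f : Prop :=
  forall M : R, exists r : R, forall u, r < enorm u -> M < f u.

Definition feasible g : set 'rV[R]_n := [set u | g u <= 0].

(* Only meaningful where both gradients are nonzero; see [is_solution]. *)
Definition sfield f g zeta u : 'rV[R]_n :=
  - ((enorm (grad f u))^-1 *: grad f u)
  - zeta *: ((enorm (grad g u))^-1 *: grad g u).

(* x solves x' = sfield x, x(0) = x0 on [0, T), inside the open set where the
   field is defined.  The increment h is restricted to 0 <= t + h, so that the
   derivative is two-sided for t > 0 and right-sided at t = 0; the values of x
   outside [0, T) are irrelevant. *)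
Definition is_solution f g zeta (x0 : 'rV[R]_n) T x : Prop :=
  x 0 = x0 /\
  forall t : R, 0 <= t -> (t%:E < T)%E ->
    [/\ grad f (x t) != 0,
        grad g (x t) != 0 &
        h^-1 *: (x (t + h) - x t) @[h --> within [set h | 0 <= t + h] 0^']
          --> sfield f g zeta (x t)].

(* [0, T) is the maximal forward interval of existence: no solution extends x
   to a longer interval. *)
Definition is_maximal_solution f g zeta (x0 : 'rV[R]_n) T x : Prop :=
  [/\ (0 < T)%E,
      is_solution f g zeta x0 T x &
      forall T' y, (T <= T')%E -> is_solution f g zeta x0 T' y ->
        (forall t : R, 0 <= t -> (t%:E < T)%E -> y t = x t) -> T' = T].

Definition is_first_hitting_time (A : set 'rV[R]_n) T x tau : Prop :=
  [/\ 0 <= tau, (tau%:E < T)%E, A (x tau) &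
      forall t : R, 0 <= t -> (t%:E < T)%E -> A (x t) -> tau <= t].

End Defs.

(* Main.v *)
Require Import Defs.
From mathcomp Require Import ring lra zify.

(** Along a solution, [f] decreases: by Cauchy-Schwarz the derivative of
    [f (x t)] is at most [- (1 - zeta) * |grad f|].  As long as the trajectory
    is feasible it therefore remains in
    [K = {u | g u <= 0 /\ f u <= f x0}], which is compact by coercivity.  On
    [K] the function [f] has a minimum [m] and [|grad f|] has a minimum
    [c > 0], so that a trajectory feasible on [[0, tau]] satisfies
    [(1 - zeta) * c * tau <= f x0 - m].  This gives the constant
    [C = (f x0 - m) / c]; it depends neither on [zeta] nor on the trajectory
    ([sublevel_bounds], [solution_descent]).

    A trajectory that never left the feasible set could then not be defined
    for all times.  If it were defined on [[0, r)] only, it would be Lipschitz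
    with values in [K], hence would converge to some [p] in [K] as [t] tends to
    [r]; both gradients are nonzero at [p], the field is continuous near [p],
    and the trajectory could be continued beyond [r] by a solution that starts
    at [p], against maximality ([solution_extension]).  Having left the
    feasible set, the trajectory has crossed [g = 0]; up to its first zero of
    [g] it is feasible, and the estimate above bounds that time
    ([first_zero]).

    The continuation needs local existence for a continuous field, which is
    proved here without integrals.  The field [sfield f g zeta] is bounded by
    [2] everywhere, also where it is not meaningful, so Euler polygons never
    escape and, by Tychonoff's theorem, have a pointwise cluster point as the
    step tends to [0].  Over a short time an Euler polygon that remains in a
    region where [F] is within [e] of [w] moves by [w] times the elapsed time,
    up to [e] times the elapsed time.  This statement involves finitely many
    instants only, hence passes to the pointwise limit, where it says that the
    limit curve has velocity [F (y t)] wherever [F] is continuous at [y t]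
    ([euler_limit_velocity]). *)

Set Implicit Arguments.
Unset Strict Implicit.
Unset Printing Implicit Defensive.

Local Open Scope classical_set_scope.
Local Open Scope ring_scope.

(** * Euler polygons and existence of solutions *)

Definition euler (R : realType) n (F : 'rV[R]_n -> 'rV[R]_n) p (h : R)
    (j : nat) :=
  iter j (fun u => u + h *: F u) p.

(** The error of replacing [F] by the constant [w] accumulates linearly, as the
    [m] steps from [i] contribute [h * e] each.  With [w = 0] this is the
    Lipschitz bound; with [w = F (y t)] it yields the velocity of the limit. *)
Lemma euler_drift (R : realType) n (F : 'rV[R]_n -> 'rV[R]_n) p h w e i m :
  0 <= h ->
  (forall l, (i <= l < i + m)%N -> `|F (euler F p h l) - w| <= e) ->
  `|euler F p h (i + m) - euler F p h i - (m%:R * h) *: w| <= m%:R * h * e.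
Proof.
move=> h0; elim: m => [|m IH] Fw.
  by rewrite addn0 subrr mul0r scale0r subr0 normr0 mul0r.
have -> : euler F p h (i + m.+1) - euler F p h i - (m.+1%:R * h) *: w =
    (euler F p h (i + m) - euler F p h i - (m%:R * h) *: w)
    + h *: (F (euler F p h (i + m)) - w).
  by rewrite addnS /=; apply/rowP => j; rewrite !mxE -natr1; ring.
rewrite (le_trans (ler_normD _ _))//.
rewrite -natr1 [leRHS](_ : _ = m%:R * h * e + h * e); last by ring.
apply: lerD.
  by apply: IH => l /andP[il lm]; rewrite Fw// il addnS ltnS ltnW.
by rewrite normrZ ger0_norm// ler_wpM2l// Fw// leq_addr addnS /= ltnS leqnn.

Qed.

Lemma truncn_grid (R : realType) (h a b : R) : 0 < h -> 0 <= a -> a <= b ->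
  exists2 m, Num.truncn (b / h) = (Num.truncn (a / h) + m)%N &
    `|m%:R * h - (b - a)| <= h.
Proof.
move=> h0 a0 ab; set i := Num.truncn (a / h); set j := Num.truncn (b / h).
have ah0 : 0 <= a / h := divr_ge0 a0 (ltW h0).
have bh0 : 0 <= b / h := divr_ge0 (le_trans a0 ab) (ltW h0).
have /andP[ia ai] := truncn_itv ah0; have /andP[jb bj] := truncn_itv bh0.
rewrite -/i in ia ai; rewrite -/j in jb bj.
have ij : (i <= j)%N.
  rewrite -ltnS -(ltr_nat R) (le_lt_trans ia)// (le_lt_trans _ bj)//.
  by rewrite ler_pM2r ?invr_gt0.
exists (j - i)%N; first by rewrite subnKC.
move: ia ai jb bj; rewrite !(ler_pdivlMr, ltr_pdivrMr)// => ia ai jb bj.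
rewrite natrB// ler_distl; move: ai bj; rewrite -!natr1; lra.
Qed.

(** [v] is the derivative of [x] at [t], one-sided when [t = 0] because only
    instants [s >= 0] are compared.  The increment form, unlike the quotient,
    can be checked on each side of [t] separately. *)
Definition velocity (R : realType) n (x : R -> 'rV[R]_n) t v :=
  forall e : R, 0 < e -> exists2 d : R, 0 < d & forall s, 0 <= s ->
    `|s - t| <= d -> `|x s - x t - (s - t) *: v| <= e * `|s - t|.

(** The Euler polygon read as a step function of time: an interpolation would
    only change the errors by [O(h)], which vanishes in the limit. *)
Definition euler_path (R : realType) n (F : 'rV[R]_n -> 'rV[R]_n) p (h t : R) :=
  euler F p h (Num.truncn (t / h)).

Lemma euler_path_drift (R : realType) n (F : 'rV[R]_n -> 'rV[R]_n) p
    (h a b e : R) w :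
  0 < h -> 0 <= a -> a <= b -> 0 <= e ->
  (forall l, (Num.truncn (a / h) <= l < Num.truncn (b / h))%N ->
    `|F (euler F p h l) - w| <= e) ->
  `|euler_path F p h b - euler_path F p h a - (b - a) *: w|
    <= (b - a + h) * e + h * `|w|.
Proof.
move=> h0 a0 ab e0 Fw; have [m bE mh] := truncn_grid h0 a0 ab.
have := @euler_drift _ _ F p h w e (Num.truncn (a / h)) m (ltW h0).
rewrite -bE => /(_ Fw) D.
set u := euler_path _ _ _ b; set v := euler_path _ _ _ a.
have -> : u - v - (b - a) *: w =
   (u - v - (m%:R * h) *: w) + (m%:R * h - (b - a)) *: w.
  by apply/rowP => j; rewrite !mxE; ring.
rewrite (le_trans (ler_normD _ _))// lerD//.
  rewrite (le_trans D)// ler_wpM2r//.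
  by move: mh; rewrite ler_distl; lra.
by rewrite normrZ ler_wpM2r.
Qed.

Lemma euler_dist (R : realType) n (F : 'rV[R]_n -> 'rV[R]_n) p (h M : R)
    i j l m :
  0 <= h -> (forall u, `|F u| <= M) ->
  (i <= j <= i + m)%N -> (i <= l <= i + m)%N ->
  `|euler F p h l - euler F p h j| <= m%:R * h * M.
Proof.
move=> h0 FM; have M0 : 0 <= M by apply: le_trans (FM 0).
wlog jl : j l / (j <= l)%N => [H|] ijm ilm.
  have [jl|/ltnW lj] := leqP j l; first exact: H.
  by rewrite distrC; apply: H.
have lm : (l - j <= m)%N by lia.
have := @euler_drift _ _ F p h 0 M j (l - j) h0.
rewrite scaler0 subr0 subnKC// => /(_ _)/wrap[k _|D]; first by rewrite subr0.
by rewrite (le_trans D)// !ler_wpM2r// ler_nat.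
Qed.

Lemma compact_closed_ball_row (R : realType) n (p : 'rV[R]_n) (r : R) :
  compact [set u | `|p - u| <= r].
Proof.
apply: bounded_closed_compact.
  exists (r + `|p|); split; first exact: num_real.
  move=> s rs u /= up; apply: le_trans (ltW rs).
  by rewrite -[u](subrK p) (le_trans (ler_normD _ _))// lerD// distrC.
exact: (@closed_closed_ball_ _ _ p r).
Qed.

Lemma nbhs_dist_lt (R : realType) n (v : 'rV[R]_n) (r : R) :
  0 < r -> nbhs v [set u | `|u - v| < r].
Proof.
move=> r0; apply/nbhs_ballP; exists r => //= u.
by rewrite mx_norm_ball /ball_ /= distrC.
Qed.

(** Up to time [t] Euler polygons stay in the ball of radius [t * M], so they
    lie in a product of compact sets.  A cluster point in the product topology
    is approached simultaneously at any finite number of instants; the three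
    offered here are those used below. *)
Lemma euler_limit (R : realType) n (F : 'rV[R]_n -> 'rV[R]_n) p (M : R) :
  (forall u, `|F u| <= M) ->
  exists y : R -> 'rV[R]_n, forall (a b c eta : R),
    0 <= a -> 0 <= b -> 0 <= c -> 0 < eta ->
    exists h : R, [/\ 0 < h, h < eta,
      `|euler_path F p h a - y a| < eta,
      `|euler_path F p h b - y b| < eta &
      `|euler_path F p h c - y c| < eta].
Proof.
move=> FM.
pose A (t : R) := [set u : 'rV[R]_n | `|p - u| <= `|t| * M].
have cA : @compact (prod_topology (fun _ : R => 'rV[R]_n))
    [set f | forall t, A t (f t)].
  by apply: tychonoff => t; exact: compact_closed_ball_row.
pose X (k : nat) : prod_topology (fun _ : R => 'rV[R]_n) :=
   fun t => if 0 <= t then euler_path F p k.+1%:R^-1 t else p.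
have M0 : 0 <= M by apply: le_trans (FM 0).
have XA : (X @ \oo) [set f | forall t, A t (f t)].
  exists 0%N => // k _ t /=; rewrite /A /X /=.
  case: ifPn => t0; last by rewrite subrr normr0 mulr_ge0.
  have k0 : 0 < k.+1%:R^-1 :> R by rewrite invr_gt0.
  have /andP[tt _] := truncn_itv (divr_ge0 t0 (ltW k0)).
  rewrite distrC.
  set j := Num.truncn _ in tt *.
  have := @euler_dist _ _ F p _ M 0 0 j j (ltW k0) FM.
  rewrite add0n !leqnn leq0n => /(_ isT isT).
  move=> /le_trans; apply.
  by rewrite ler_wpM2r// ger0_norm// -ler_pdivlMr.
have [y [_ ycl]] := cA _ _ XA.
exists y => a b c eta a0 b0 c0 eta0.
have nb (t : R) : nbhs (y : prod_topology (fun _ : R => 'rV[R]_n))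
    [set f | `|f t - y t| < eta].
  apply: (@proj_continuous R (fun _ => 'rV[R]_n) t y
    [set u | `|u - y t| < eta]).
  exact: (nbhs_dist_lt (y t : 'rV[R]_n) eta0).
have FF : (X @ \oo) [set X k | k in [set k : nat | k.+1%:R^-1 < eta]].
  have := near_infty_natSinv_lt (PosNum eta0).
  by apply: filterS => k kh; exists k.
have nabc := @filterI _ _ (nbhs_filter (y : prod_topology _)) _ _
  (@filterI _ _ (nbhs_filter (y : prod_topology _)) _ _ (nb a) (nb b)) (nb c).
have [_ [[k /= ke <-] [[+ +] +]]] := ycl _ _ FF nabc.
rewrite /= /X a0 b0 c0 => ha hb hc.
by exists k.+1%:R^-1; split => //; rewrite invr_gt0.
Qed.

(** Peano's theorem for a globally bounded field.  Continuity of [F] is asked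
    pointwise along the curve, so a field that is continuous only on an open
    set gives a solution for as long as the curve stays in it. *)
Lemma euler_limit_velocity (R : realType) n (F : 'rV[R]_n -> 'rV[R]_n) p
    (M : R) :
  (forall u, `|F u| <= M) ->
  exists y : R -> 'rV[R]_n, y 0 = p /\
    (forall a b, 0 <= a -> a <= b -> `|y b - y a| <= (b - a) * M) /\
    forall t, 0 <= t -> {for y t, continuous F} -> velocity y t (F (y t)).
Proof.
move=> FM; have [y yE] := euler_limit p FM.
have M0 : 0 <= M by apply: le_trans (FM 0).
exists y; split; [|split].
- apply/eqP; rewrite -subr_eq0 -normr_eq0 eq_le normr_ge0 andbT.
  apply/ler_addgt0Pr => eta eta0; rewrite add0r.
  have [h [h0 he + _ _]] := yE 0 0 0 eta (lexx _) (lexx _) (lexx _) eta0.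
  by rewrite /euler_path mul0r truncn0 /= distrC => /ltW.
- move=> a b a0 ab; apply/ler_addgt0Pr => eta eta0.
  have b0 := le_trans a0 ab.
  have eM : 0 < eta / (2 + M) by rewrite divr_gt0// ltr_wpDr.
  have [h [h0 he ha hb _]] := yE a b 0 _ a0 b0 (lexx _) eM.
  have := @euler_path_drift _ _ F p h a b M 0 h0 a0 ab M0.
  rewrite normr0 mulr0 addr0 scaler0 subr0 => /(_ _)/wrap[|D].
    by move=> l _; rewrite subr0.
  set u := euler_path _ _ _ b in hb D; set v := euler_path _ _ _ a in ha D.
  have -> : y b - y a = (y b - u) + (v - y a) + (u - v).
    by apply/rowP => j; rewrite !mxE; ring.
  rewrite (le_trans (ler_normD _ _))//.
  rewrite (le_trans (lerD (ler_normD _ _) D))// (distrC (y b)).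
  have : eta / (2 + M) * (2 + M) = eta by rewrite divfK// gt_eqF// ltr_wpDr.
  move: (eta / (2 + M)) eM he ha hb => c c0 hc ha hb.
  have : h * M <= c * M by rewrite ler_wpM2r// ltW.
  by rewrite !mulrDl mulrDr; lra.
- move=> t t0 Fc e e0.
  have /cvgrPdist_le/(_ _ e0)/nbhs_ballP[r /= r0 rF] := Fc.
  rewrite mx_norm_ball in rF.
  set w := F (y t) in rF *.
  have M1 : 0 < 4 * (M + 1) by rewrite mulr_gt0// ltr_wpDl.
  (* Within time [d] and with step at most [d], the polygon moves by at most
     [2 * d * M]; adding its distance to [y t] still leaves it in the ball of
     radius [r] around [y t], where [F] is within [e] of [w]. *)
  pose d := r / (4 * (M + 1)).
  have d0 : 0 < d by rewrite divr_gt0.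
  have dr : d * (4 * (M + 1)) = r by rewrite divfK// gt_eqF.
  (* A two-sided estimate around [t] covers the increments on both sides. *)
  suff H a b : 0 <= a -> a <= t -> t <= b -> b - a <= d ->
      `|y b - y a - (b - a) *: w| <= (b - a) * e.
    exists d => // s s0; have [st|ts] := leP s t => sd.
      have := H s t s0 st (lexx t).
      have nst : `|s - t| = t - s by rewrite ler0_norm ?subr_le0// opprB.
      rewrite nst in sd *.
      move=> /(_ sd); rewrite mulrC; apply: le_trans.
      rewrite -normrN le_eqVlt; apply/orP; left; apply/eqP; congr `|_|.
      by apply/rowP => j; rewrite !mxE; ring.
    rewrite mulrC gtr0_norm ?subr_gt0// in sd *.
    exact: (H t s t0 (lexx t) (ltW ts)).
  move=> a0 a_t tb bad; apply/ler_addgt0Pr => eta eta0.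
  have b0 := le_trans t0 tb; have ab := le_trans a_t tb.
  (* Passing from [y] to the polygon costs [c] at each end of [[a, b]], and
     the step [h < c] costs [h * (e + |w|)]. *)
  pose K := 3 + e + `|w|.
  have K0 : 0 < K by rewrite /K; have := normr_ge0 w; lra.
  pose c := Num.min d (eta / K).
  have c0 : 0 < c by rewrite lt_min d0 divr_gt0.
  have [h [h0 hc ha hb ht]] := yE a b t c a0 b0 t0 c0.
  have cd : c <= d by rewrite ge_min lexx.
  have cK : c * K <= eta by rewrite -ler_pdivlMr// ge_min lexx orbT.
  have := @euler_path_drift _ _ F p h a b e w h0 a0 ab (ltW e0).
  move=> /(_ _)/wrap[l lab|D].
    rewrite distrC; apply: rF => /=.
    have [m bE mh] := truncn_grid h0 a0 ab.
    have [m1 tE _] := truncn_grid h0 a0 a_t.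
    have [m2 bE2 _] := truncn_grid h0 t0 tb.
    have := @euler_dist _ _ F p h M
      (Num.truncn (a / h)) (Num.truncn (t / h)) l m.
    move=> /(_ (ltW h0) FM)/(_ _ _)/wrap[||D].
    - by rewrite -bE bE2 leq_addr tE leq_addr.
    - by rewrite -bE; case/andP: lab => -> /ltnW ->.
    set z := euler _ _ _ l in D *; set u := euler_path _ _ _ t in ht.
    rewrite -/(euler_path F p h t) -/u in D.
    have -> : y t - z = (y t - u) + (u - z).
      by apply/rowP => j; rewrite !mxE; ring.
    rewrite (le_lt_trans (ler_normD _ _))// (distrC (y t)) (distrC u z).
    have : m%:R * h * M <= (2 * d) * M.
      by rewrite ler_wpM2r//; move: mh; rewrite ler_distl; lra.
    have dM : 0 <= d * M by rewrite mulr_ge0// ltW.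
    move: D ht cd d0; rewrite -dr.
    by lra.
  set u := euler_path _ _ _ b in hb D; set v := euler_path _ _ _ a in ha D.
  have -> : y b - y a - (b - a) *: w =
      (y b - u) + (v - y a) + (u - v - (b - a) *: w).
    by apply/rowP => j; rewrite !mxE; ring.
  rewrite (le_trans (ler_normD _ _))//.
  rewrite (le_trans (lerD (ler_normD _ _) D))// (distrC (y b)).
  have : h * e <= c * e by rewrite ler_pM2r// ltW.
  have : h * `|w| <= c * `|w| by rewrite ler_wpM2r// ltW.
  by move: cK; rewrite /K !mulrDl !mulrDr; lra.
Qed.

(** * The Euclidean norm and the field *)

Definition dot (R : realType) n (u v : 'rV[R]_n) : R :=
  \sum_i u ord0 i * v ord0 i.

Lemma enorm_ge0 (R : realType) n (u : 'rV[R]_n) : 0 <= enorm u.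
Proof. exact: sqrtr_ge0. Qed.

Lemma sqr_enorm (R : realType) n (u : 'rV[R]_n) : enorm u ^+ 2 = dot u u.
Proof.
rewrite /enorm sqr_sqrtr; first by apply: eq_bigr => i _; rewrite expr2.
by apply: sumr_ge0 => i _; exact: sqr_ge0.
Qed.

Lemma norm_le_enorm (R : realType) n (u : 'rV[R]_n) : `|u| <= enorm u.
Proof.
rewrite [leLHS]mx_normrE; apply/bigmax_leP; split; first exact: enorm_ge0.
move=> [i j] _ /=; rewrite (ord1 i) -sqrtr_sqr ler_wsqrtr//.
by rewrite (bigD1 j)//= lerDl sumr_ge0// => k _; exact: sqr_ge0.
Qed.

Lemma enorm_gt0 (R : realType) n (u : 'rV[R]_n) : u != 0 -> 0 < enorm u.
Proof. by move=> u0; rewrite (lt_le_trans _ (norm_le_enorm u))// normr_gt0. Qed.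

(** The lower half of Cauchy-Schwarz, read off the nonnegative square
    norm of [|v| u + |u| v]. *)
Lemma dot_ge (R : realType) n (u v : 'rV[R]_n) : u != 0 -> v != 0 ->
  - (enorm u * enorm v) <= dot u v.
Proof.
move=> /enorm_gt0 u0 /enorm_gt0 v0.
set a := enorm u in u0 *; set b := enorm v in v0 *.
have : 0 <= \sum_i (b * u ord0 i + a * v ord0 i) ^+ 2.
  by apply: sumr_ge0 => i _; exact: sqr_ge0.
have -> : \sum_i (b * u ord0 i + a * v ord0 i) ^+ 2 =
    b ^+ 2 * dot u u + 2 * (a * b) * dot u v + a ^+ 2 * dot v v.
  rewrite /dot !mulr_sumr -!big_split/=; apply: eq_bigr => i _; ring.
rewrite -!sqr_enorm -/a -/b.
rewrite [X in 0 <= X -> _](_ : _ = (2 * (a * b)) * (dot u v + a * b));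
  last by ring.
by rewrite pmulr_rge0 ?mulr_gt0//; lra.
Qed.

Lemma norm_normalize (R : realType) n (u : 'rV[R]_n) :
  `|(enorm u)^-1 *: u| <= 1.
Proof.
have [->|u0] := eqVneq u 0; first by rewrite scaler0 normr0.
rewrite normrZ ger0_norm ?invr_ge0 ?enorm_ge0// mulrC.
by rewrite ler_pdivrMr ?enorm_gt0// mul1r norm_le_enorm.
Qed.

(** The inverse of [0] being [0], the bound holds even where a gradient
    vanishes; this makes Euler polygons of [sfield] globally bounded. *)
Lemma norm_sfield (R : realType) n (f g : 'rV[R]_n -> R) zeta u :
  0 <= zeta -> zeta < 1 -> `|sfield f g zeta u| <= 2.
Proof.
move=> z0 z1; rewrite /sfield (le_trans (ler_normB _ _))// normrN.
rewrite (normrZ zeta) (ger0_norm z0).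
have /(ler_wpM2l z0) := norm_normalize (grad g u).
by have := norm_normalize (grad f u); lra.
Qed.

(** The direction [- grad g / |grad g|] can increase [f] at speed at most
    [|grad f|], and it is weighted by [zeta < 1]. *)
Lemma dot_sfield (R : realType) n (f g : 'rV[R]_n -> R) zeta u : 0 <= zeta ->
  grad f u != 0 -> grad g u != 0 ->
  dot (grad f u) (sfield f g zeta u) <= - ((1 - zeta) * enorm (grad f u)).
Proof.
move=> z0 f0 g0; have := dot_ge f0 g0.
have := sqr_enorm (grad f u).
have := enorm_gt0 f0; have := enorm_gt0 g0.
have -> : dot (grad f u) (sfield f g zeta u) =
    - ((enorm (grad f u))^-1 * dot (grad f u) (grad f u))
    - zeta * (enorm (grad g u))^-1 * dot (grad f u) (grad g u).
  rewrite /dot !mulr_sumr -!sumrN -!big_split/=; apply: eq_bigr => i _.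
  by rewrite /sfield !mxE; ring.
move: (enorm (grad f u)) (enorm (grad g u)) => a b b0 a0.
move: (dot (grad f u) (grad g u)) (dot _ _) => d s <- ab.
rewrite expr2 mulKf ?gt_eqF//.
have : - a <= b^-1 * d.
  by rewrite mulrC ler_pdivlMr// mulNr.
move=> /(ler_wpM2l z0); lra.
Qed.

Lemma enorm_continuous (R : realType) n : continuous (@enorm R n).
Proof.
move=> u; apply: (@continuous_comp _ _ _
  (fun u : 'rV[R]_n => \sum_(i < n) u ord0 i ^+ 2) Num.sqrt);
  last exact: sqrt_continuous.
have csq i : continuous (fun v : 'rV[R]_n => v ord0 i ^+ 2).
  by move=> v; apply: (continuousM (x := v)); exact: coord_continuous.
apply: (@cvg_big _ _ _ _ _ (@add_continuous R^o) _ (nbhs u)) => i _.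
exact: csq.
Qed.

Lemma normalize_continuous (R : realType) n (G : 'rV[R]_n -> 'rV[R]_n) u :
  {for u, continuous G} -> G u != 0 ->
  {for u, continuous (fun v => (enorm (G v))^-1 *: G v)}.
Proof.
move=> cG G0.
have cN : enorm (G v) @[v --> u] --> enorm (G u).
  exact: (@continuous_comp _ _ _ G (@enorm R n) _ cG (@enorm_continuous R n _)).
have N0 : enorm (G u) != 0 by rewrite gt_eqF// enorm_gt0.
exact: (cvgZ (cvgV N0 cN) cG).
Qed.

Lemma sfield_continuous (R : realType) n (f g : 'rV[R]_n -> R) zeta u :
  {for u, continuous (grad f)} -> {for u, continuous (grad g)} ->
  grad f u != 0 -> grad g u != 0 -> {for u, continuous (sfield f g zeta)}.
Proof.
move=> cf cg f0 g0.
have nf := normalize_continuous cf f0; have ng := normalize_continuous cg g0.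
exact: (cvgB (cvgN nf) (cvgZ (cvg_cst zeta) ng)).
Qed.

Lemma diff_grad (R : realType) n (f : 'rV[R]_n -> R) u v :
  differentiable f u -> 'd f u v = dot (grad f u) v.
Proof.
move=> df; rewrite {1}[v]row_sum_delta linear_sum; apply: eq_bigr => i _.
by rewrite linearZ/= -deriveE// mxE mulrC.
Qed.

(** * Curves with a velocity *)

Lemma norm_increment (R : realType) (V : normedModType R) (w v : V) (h : R) :
  h != 0 -> `|w - h *: v| = `|h| * `|v - h^-1 *: w|.
Proof.
by move=> h0; rewrite -normrZ scalerBr scalerA divff// scale1r distrC.
Qed.

Lemma velocityP (R : realType) n (x : R -> 'rV[R]_n) t v :
  (h^-1 *: (x (t + h) - x t) @[h --> within [set h | 0 <= t + h] 0^'] --> v)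
  <-> velocity x t v.
Proof.
split=> [xv e e0|xv].
  have /cvgrPdist_le/(_ _ e0)/nbhs_ballP[d /= d0 dP] := xv.
  exists (d / 2); first by rewrite divr_gt0.
  move=> s s0 sd; have [->|st] := eqVneq s t.
    by rewrite !subrr scale0r subr0 !normr0 mulr0.
  have st0 : s - t != 0 by rewrite subr_eq0.
  rewrite norm_increment// mulrC ler_wpM2r//.
  have := dP (s - t); rewrite /ball /= sub0r normrN subrKC => -> //.
  by rewrite (le_lt_trans sd)// ltr_pdivrMr// ltr_pMr// ltr1n.
apply/cvgrPdist_le => e e0; have [d d0 dP] := xv e e0.
apply/nbhs_ballP; exists d => //= h; rewrite /ball /= sub0r normrN => hd h0 th.
have hn : 0 < `|h| by rewrite normr_gt0.
rewrite -(ler_pM2l hn) -norm_increment// mulrC.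
by have := dP _ th; rewrite [t + h]addrC addrK; apply; exact: ltW.
Qed.

Lemma velocity_is_derive (R : realType) n (x : R -> 'rV[R]_n) t v :
  0 < t -> velocity x t v -> is_derive t 1 x v.
Proof.
move=> t0 /velocityP xv.
have H : h^-1 *: ((x \o shift t) (h *: 1) - x t) @[h --> 0^'] --> v.
  apply/cvgrPdist_le => e e0.
  have /cvgrPdist_le/(_ _ e0)/nbhs_ballP[d /= d0 dP] := xv.
  apply/nbhs_ballP; exists (Num.min d t); first by rewrite /= lt_min d0.
  move=> h; rewrite /ball /= sub0r normrN lt_min => /andP[hd ht] h0.
  have := dP h; rewrite /ball /= sub0r normrN => /(_ hd h0).
  rewrite [h *: 1]mulr1 addrC; apply.
  by move: ht; rewrite ltr_norml; lra.
apply: DeriveDef; last exact: cvg_lim H.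
by apply/cvg_ex; exists v.
Qed.

Lemma velocity_continuous (R : realType) n (x : R -> 'rV[R]_n) t v :
  velocity x t v -> x s @[s --> within [set s | 0 <= s] (nbhs t)] --> x t.
Proof.
move=> xv; apply/cvgrPdist_le => e e0.
have [d d0 dP] := xv 1 ltr01.
have K0 : 0 < 1 + `|v| by rewrite ltr_pwDl.
apply/nbhs_ballP; exists (Num.min d (e / (1 + `|v|))).
  by rewrite /= lt_min d0 divr_gt0.
move=> s; rewrite /ball /= lt_min distrC ltr_pdivlMr// => /andP[sd se] s0.
rewrite distrC -[x s - x t](subrK ((s - t) *: v)).
rewrite (le_trans (ler_normD _ _))// normrZ.
have := dP s s0 (ltW sd); lra.
Qed.

(** At the left end [a = 0] the velocity only controls instants [s >= 0], which
    is what continuity within [[a, b]] asks for. *)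
Lemma velocity_comp_continuous (R : realType) n (phi : 'rV[R]_n -> R)
    (x v : R -> 'rV[R]_n) (a b : R) : 0 <= a ->
  (forall t, a <= t <= b -> velocity x t (v t)) ->
  (forall t, a <= t <= b -> {for x t, continuous phi}) ->
  {within `[a, b], continuous (phi \o x)}.
Proof.
move=> a0 xv cphi; apply/subspace_continuousP => t /=.
rewrite in_itv/= => tab.
apply: (@cvg_comp _ _ _ x phi _ (nbhs (x t))); last exact: cphi.
have H := velocity_continuous (xv t tab).
apply: cvg_trans H.
apply: cvg_app => S HS.
have {}HS : nbhs t (fun s => 0 <= s -> S s) := HS.
suff : nbhs t (fun s => s \in `[a, b] -> S s) by [].
apply: filterS HS => s Hs; rewrite in_itv/= => /andP[as_ _].
by apply: Hs; exact: le_trans as_.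
Qed.

Lemma velocity_MVT (R : realType) n (phi : 'rV[R]_n -> R)
    (x v : R -> 'rV[R]_n) (a b : R) : 0 <= a -> a < b ->
  (forall t, a <= t <= b -> velocity x t (v t)) ->
  (forall t, a <= t <= b -> differentiable phi (x t)) ->
  exists2 c, a < c < b & phi (x b) - phi (x a) = 'd phi (x c) (v c) * (b - a).
Proof.
move=> a0 ab xv dphi.
have := @MVT R (phi \o x) (fun c => 'd phi (x c) (v c)) a b ab.
move=> /(_ _ _)/wrap[c||[c]].
- rewrite in_itv/= => /andP[ac cb].
  have cab : a <= c <= b by rewrite !ltW.
  have xc := velocity_is_derive (le_lt_trans a0 ac) (xv c cab).
  have dx : differentiable x c by apply/derivable1_diffP; case: xc.
  have dp := dphi c cab.
  apply: DeriveDef.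
    by apply/derivable1_diffP; apply: differentiable_comp.
  rewrite deriveE; last exact: differentiable_comp.
  have <- : 'd x c 1 = v c by rewrite -deriveE//; case: xc.
  by rewrite diff_comp.
- apply: velocity_comp_continuous xv _ => // t tab.
  by apply: differentiable_continuous; exact: dphi.
- by rewrite in_itv/= => cab fE; exists c.
Qed.

Lemma diff_coord (R : realType) n (j : 'I_n) (u v : 'rV[R]_n) :
  'd (fun w : 'rV[R]_n => w ord0 j : R) u v = v ord0 j.
Proof.
have @p : {linear 'rV[R]_n -> R}.
  by exists (fun w : 'rV[R]_n => w ord0 j); do 2![eexists]; do ?[constructor];
     rewrite ?mxE// => ? *; rewrite ?mxE//; move=> ?; rewrite !mxE.
rewrite (_ : (fun _ => _) = p)// diff_lin//; exact: coord_continuous.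
Qed.

Lemma coord_le_norm (R : realType) n (u : 'rV[R]_n) j : `|u ord0 j| <= `|u|.
Proof.
rewrite [leRHS]mx_normrE.
exact: (le_bigmax_cond _ (fun ij => `|u ij.1 ij.2|) (j := (ord0, j))).
Qed.

(** Apply the mean value theorem to each coordinate: the intermediate points
    differ, but the bound on [v - w] is uniform. *)
Lemma velocity_increment_le (R : realType) n (x v : R -> 'rV[R]_n) w
    (a b e : R) : 0 <= a -> a <= b -> 0 <= e ->
  (forall t, a <= t <= b -> velocity x t (v t)) ->
  (forall t, a <= t <= b -> `|v t - w| <= e) ->
  `|x b - x a - (b - a) *: w| <= (b - a) * e.
Proof.
move=> a0 ab e0 xv vw; have [<-|anb] := eqVneq a b.
  by rewrite !subrr scale0r subr0 normr0 mul0r.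
have {anb} a_b : a < b by rewrite lt_neqAle anb.
have ba : 0 <= b - a by rewrite subr_ge0.
rewrite [leLHS]mx_normrE; apply/bigmax_leP; split; first exact: mulr_ge0.
move=> [i j] _ /=; rewrite (ord1 i) {i}.
have [|c /andP[ac cb]] := velocity_MVT (phi := fun u => u ord0 j) a0 a_b xv.
  by move=> t _; exact: differentiable_coord.
rewrite diff_coord !mxE => ->.
rewrite (mulrC (v c _ _)) -mulrBr normrM ger0_norm// ler_wpM2l//.
apply: le_trans (vw c _); last by rewrite !ltW.
by have := coord_le_norm (v c - w) j; rewrite !mxE.
Qed.

Lemma velocity_lipschitz (R : realType) n (x v : R -> 'rV[R]_n) (a b M : R) :
  0 <= a -> a <= b -> 0 <= M ->
  (forall t, a <= t <= b -> velocity x t (v t)) ->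
  (forall t, a <= t <= b -> `|v t| <= M) ->
  `|x b - x a| <= (b - a) * M.
Proof.
move=> a0 ab M0 xv vM.
have := velocity_increment_le (w := 0) a0 ab M0 xv.
rewrite scaler0 subr0; apply=> t tab; rewrite subr0; exact: vM.
Qed.

(** * Continuation of solutions *)

(** A Lipschitz curve converges at [r] as soon as it clusters there; comparing
    with instants close to [r] where the curve is near [p] gives the rate. *)
Lemma cluster_left_dist (R : realType) n (x v : R -> 'rV[R]_n) p (r M t : R) :
  0 <= M -> 0 <= t -> t < r ->
  (forall t, 0 <= t -> t < r -> velocity x t (v t)) ->
  (forall t, 0 <= t -> t < r -> `|v t| <= M) ->
  cluster (x @ r^'-) p -> `|x t - p| <= (r - t) * M.
Proof.
move=> M0 t0 tr xv vM px; apply/ler_addgt0Pr => eta eta0.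
have FF : (x @ r^'-) [set x s | s in [set s | t < s < r]].
  have : \forall s \near r^'-, t < s < r.
    by near=> s; apply/andP; split.
  by apply: filterS => s str; exists s.
have [_ [[s /= /andP[ts sr] <-] sp]] := px _ _ FF (nbhs_dist_lt p eta0).
rewrite -(subrK (x s) (x t)) -addrA (le_trans (ler_normD _ _))//.
apply: lerD (ltW sp); rewrite distrC.
have H t' : t <= t' <= s -> 0 <= t' /\ t' < r.
  by move=> /andP[tt' t's]; rewrite (le_trans t0 tt') (le_lt_trans t's sr).
apply: (@le_trans _ _ ((s - t) * M)).
  apply: velocity_lipschitz (ltW ts) _ _ _ => // t' /H[]; [exact: xv|exact: vM].
by rewrite ler_wpM2r// lerB// ltW.
Unshelve. all: by end_near.
Qed.

(** The left derivative at [r] of the curve completed by [p] is the limit of its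
    velocities: the increment estimate on [[s, s']] is carried to [s' = r]. *)
Lemma left_velocity (R : realType) n (x v : R -> 'rV[R]_n) p w (r M s e : R) :
  0 <= M -> 0 < e -> 0 <= s -> s < r ->
  (forall t, 0 <= t -> t < r -> velocity x t (v t)) ->
  (forall t, 0 <= t -> t < r -> `|x t - p| <= (r - t) * M) ->
  (forall t, s <= t -> t < r -> `|v t - w| <= e) ->
  `|x s - p - (s - r) *: w| <= e * (r - s).
Proof.
move=> M0 e0 s0 sr xv xp vw; apply/ler_addgt0Pr => eta eta0.
have K0 : 0 < M + `|w| + 1 by have := normr_ge0 w; lra.
(* [s' = r - c] is close enough to [r] for the remaining piece, of size at
   most [c * (M + |w|)], to be absorbed by [eta]. *)
pose c := Num.min (r - s) (eta / (M + `|w| + 1)).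
have c0 : 0 < c by rewrite lt_min subr_gt0 sr divr_gt0.
have cr : c <= r - s by rewrite ge_min lexx.
have cK : c * (M + `|w| + 1) <= eta by rewrite -ler_pdivlMr// ge_min lexx orbT.
pose s' := r - c.
have ss' : s <= s' by rewrite /s'; lra.
have s'r : s' < r by rewrite /s'; lra.
have -> : x s - p - (s - r) *: w =
    - (x s' - x s - (s' - s) *: w) + ((x s' - p) + (r - s') *: w).
  by apply/rowP => j; rewrite !mxE; ring.
rewrite (le_trans (ler_normD _ _))// normrN.
have H t' : s <= t' <= s' -> 0 <= t' /\ t' < r.
  by move=> /andP[tt' t's]; rewrite (le_trans s0 tt') (le_lt_trans t's s'r).
apply: lerD.
  apply: (@le_trans _ _ ((s' - s) * e)).
    apply: velocity_increment_le ss' (ltW e0) _ _ => // t'.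
      by move=> /H[]; exact: xv.
    by move=> t's; have [_ ?] := H _ t's; apply: vw => //; case/andP: t's.
  by rewrite mulrC ler_wpM2l ?(ltW e0)// lerB// ltW.
rewrite (le_trans (ler_normD _ _))// normrZ.
have := xp s' (le_trans s0 ss') s'r.
have -> : r - s' = c by rewrite /s'; ring.
rewrite gtr0_norm//; move: cK; rewrite !mulrDr; lra.
Qed.

Definition glue (R : realType) n (x z : R -> 'rV[R]_n) (r s : R) :=
  if s < r then x s else z (s - r).

Lemma glue_velocity_before (R : realType) n (x z : R -> 'rV[R]_n) (r t : R) v :
  t < r -> velocity x t v -> velocity (glue x z r) t v.
Proof.
move=> tr xv e e0; have [d d0 dP] := xv e e0.
exists (Num.min d ((r - t) / 2)).
  by rewrite lt_min d0 divr_gt0// subr_gt0.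
move=> s s0; rewrite le_min => /andP[sd]; rewrite ler_norml => /andP[_ sr].
rewrite /glue tr ifT; first exact: dP.
by lra.
Qed.

Lemma glue_velocity_after (R : realType) n (x z : R -> 'rV[R]_n) (r t : R) v :
  r < t -> velocity z (t - r) v -> velocity (glue x z r) t v.
Proof.
move=> rt zv e e0; have [d d0 dP] := zv e e0.
exists (Num.min d (t - r)); first by rewrite lt_min d0 subr_gt0.
move=> s s0; rewrite le_min => /andP[sd]; rewrite ler_norml => /andP[sr _].
have st : s - r - (t - r) = s - t by ring.
rewrite /glue !ifF ?(lt_gtF rt) ?le_gtF//; last by lra.
have := dP (s - r); rewrite st; apply => //; lra.
Qed.

Lemma glue_velocity_at (R : realType) n (x z : R -> 'rV[R]_n) (r : R) w :
  (forall e, 0 < e -> exists2 d, 0 < d & forall s, 0 <= s -> s < r ->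
     r - s <= d -> `|x s - z 0 - (s - r) *: w| <= e * (r - s)) ->
  velocity z 0 w -> velocity (glue x z r) r w.
Proof.
move=> xw zw e e0; have [d d0 dP] := xw e e0; have [d' d'0 d'P] := zw e e0.
exists (Num.min d d'); first by rewrite lt_min d0.
move=> s s0; rewrite le_min => /andP[sd sd'].
rewrite /glue ltxx subrr; case: ltP => sr.
  have E : `|s - r| = r - s by rewrite distrC gtr0_norm// subr_gt0.
  by rewrite E in sd *; exact: dP.
by have := d'P (s - r); rewrite subr0; apply => //; rewrite subr_ge0.
Qed.

Lemma solution_velocity (R : realType) n (f g : 'rV[R]_n -> R) zeta x0 T x t :
  is_solution f g zeta x0 T x -> 0 <= t -> (t%:E < T)%E ->
  velocity x t (sfield f g zeta (x t)).
Proof. by move=> [_ sol] t0 tT; have [_ _ /velocityP] := sol t t0 tT. Qed.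

(** The solution is prolonged by the Euler limit from [p].  It stays where both
    gradients are nonzero for a time [rho / 2], since its speed is at most [2]
    and they are nonzero on the ball of radius [rho] around [p]. *)
Lemma solution_extension (R : realType) n (f g : 'rV[R]_n -> R) zeta x0
    (r : R) x p :
  0 <= zeta -> zeta < 1 -> 0 < r ->
  continuous (grad f) -> continuous (grad g) ->
  is_solution f g zeta x0 r%:E x ->
  cluster (x @ r^'-) p -> grad f p != 0 -> grad g p != 0 ->
  exists d : R, 0 < d /\ exists y,
    is_solution f g zeta x0 (r + d)%:E y /\
    forall t, 0 <= t -> t < r -> y t = x t.
Proof.
move=> z0 z1 r0 cf cg sol px fp gp.
pose F := sfield f g zeta.
have FM u : `|F u| <= 2 by exact: norm_sfield.
have xv t : 0 <= t -> t < r -> velocity x t (F (x t)).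
  by move=> t0 tr; apply: solution_velocity sol t0 _; rewrite lte_fin.
have xp t : 0 <= t -> t < r -> `|x t - p| <= (r - t) * 2.
  by move=> t0 tr; apply: cluster_left_dist t0 tr xv _ px.
have cF u : grad f u != 0 -> grad g u != 0 -> {for u, continuous F}.
  by move=> fu gu; apply: sfield_continuous => //; [exact: cf|exact: cg].
have [z [zp [zL zv]]] := euler_limit_velocity p FM.
have [rho rho0 rhoP] : exists2 rho : R, 0 < rho & forall u, `|p - u| < rho ->
    grad f u != 0 /\ grad g u != 0.
  have nz (G : 'rV[R]_n -> 'rV[R]_n) : {for p, continuous G} -> G p != 0 ->
      \forall u \near p, G u != 0.
    by move=> cG Gp; exact: (cvgr_neq0 _ cG Gp).
  have /nbhs_ballP := @filterI _ _ (nbhs_filter p) _ _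
    (nz _ (cf p) fp) (nz _ (cg p) gp).
  move=> [rho /= rho0 rhoP].
  by exists rho => // u; move: (rhoP u); rewrite mx_norm_ball.
have zU t : 0 <= t -> t < rho / 2 -> grad f (z t) != 0 /\ grad g (z t) != 0.
  move=> t0 td; apply: rhoP; rewrite distrC -zp.
  by apply: le_lt_trans (zL 0 t (lexx _) t0) _; lra.
exists (rho / 2); split; first by rewrite divr_gt0.
exists (glue x z r); split; last by move=> t _ tr; rewrite /glue tr.
split; first by rewrite /glue r0; case: sol.
move=> t t0; rewrite lte_fin => td; rewrite -/(F _).
have [tr|rt] := ltP t r.
  have gt : glue x z r t = x t by rewrite /glue tr.
  have [|f0 g0 _] := sol.2 t t0; first by rewrite lte_fin.
  split; [by rewrite gt|by rewrite gt|apply/velocityP; rewrite gt].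
  by apply: glue_velocity_before => //; exact: xv.
have gt : glue x z r t = z (t - r) by rewrite /glue ltNge rt.
have tr0 : 0 <= t - r by rewrite subr_ge0.
have [|f0 g0] := zU (t - r) tr0; first by lra.
split; [by rewrite gt|by rewrite gt|apply/velocityP; rewrite gt].
have zvt := zv _ tr0 (cF _ f0 g0).
move: rt; rewrite le_eqVlt => /predU1P[rt|rt]; last exact: glue_velocity_after.
move: zvt; rewrite -rt subrr => zvt; apply: glue_velocity_at => // e e0.
rewrite zp.
have /cvgrPdist_le/(_ _ e0)/nbhs_ballP[d /= d0 dP] := cF p fp gp.
rewrite mx_norm_ball in dP.
exists (d / 4); first by rewrite divr_gt0.
move=> s s0 sr sd.
apply: (left_velocity (M := 2) _ e0 s0 sr xv xp) => // s' ss' s'r.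
rewrite distrC; apply: dP; rewrite /ball_ /= distrC.
have := xp s' (le_trans s0 ss') s'r; lra.
Qed.

(** * Descent of f and exit time *)

Lemma C2_continuous (R : realType) n (f : 'rV[R]_n -> R) : C2 f -> continuous f.
Proof. by move=> [df _ _] u; exact: differentiable_continuous. Qed.

Lemma C2_grad_continuous (R : realType) n (f : 'rV[R]_n -> R) :
  C2 f -> continuous (grad f).
Proof. by move=> [_ dg _] u; exact: differentiable_continuous. Qed.

Lemma sublevel_compact (R : realType) n (f g : 'rV[R]_n -> R) (M : R) :
  coercive f -> continuous f -> continuous g ->
  compact (feasible g `&` [set u | f u <= M]).
Proof.
move=> cof cf cg; apply: bounded_closed_compact.
  have [r rP] := cof M; exists r; split; first exact: num_real.
  move=> s rs u [_ /= fu]; apply: le_trans (norm_le_enorm u) _.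
  apply: le_trans (ltW rs); rewrite leNgt; apply/negP => /rP.
  by rewrite ltNge fu.
by apply: closedI; apply: (preimage_closed _ (@closed_le _ _)) => u _;
  [exact: cg|exact: cf].
Qed.

(** The bounds come from compactness of the feasible part of a sublevel set;
    they depend on [f], [g] and [M] only, whence the uniformity in [zeta]. *)
Lemma sublevel_bounds (R : realType) n (f g : 'rV[R]_n -> R) (M : R) u0 :
  coercive f -> continuous f -> continuous g -> continuous (grad f) ->
  (forall u, feasible g u -> grad f u != 0) ->
  feasible g u0 -> f u0 <= M ->
  exists c m : R, 0 < c /\ forall u, feasible g u -> f u <= M ->
    c <= enorm (grad f u) /\ m <= f u.
Proof.
move=> cof cf cg cdf f0 gu0 fu0.
set K := feasible g `&` [set u | f u <= M].
have cK : compact K by exact: sublevel_compact.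
have K0 : K !=set0 by exists u0.
have [|a Ka aP] := EVT_min_rV (f := fun u => enorm (grad f u)) K0 cK.
  apply: continuous_subspaceT => u.
  exact: (@continuous_comp _ _ _ (grad f) (@enorm R n) _ (cdf u)
    (@enorm_continuous R n _)).
have [|b Kb bP] := EVT_min_rV (f := f) K0 cK.
  exact: continuous_subspaceT.
exists (enorm (grad f a)), (f b); split.
  by apply/enorm_gt0/f0; move: Ka; rewrite inE => -[].
move=> u gu fu; have uK : u \in K by rewrite inE.
by split; [exact: aP|exact: bP].
Qed.

(** Mean value theorem for [f] along the solution, with the slope bounded by
    [dot_sfield].  With [c = 0] it says that [f] never exceeds [f x0]. *)
Lemma solution_descent (R : realType) n (f g : 'rV[R]_n -> R) zeta x0 T x
    (c tau : R) :
  (forall u, differentiable f u) ->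
  0 <= zeta -> zeta < 1 -> is_solution f g zeta x0 T x ->
  0 <= tau -> (tau%:E < T)%E ->
  (forall t, 0 <= t -> t <= tau -> c <= enorm (grad f (x t))) ->
  (1 - zeta) * c * tau <= f x0 - f (x tau).
Proof.
move=> df z0 z1 sol; have x00 : x 0 = x0 by case: sol.
rewrite le_eqVlt => /predU1P[<- _ _|tau0 tauT cP].
  by rewrite x00 mulr0 subrr.
have tT t : t <= tau -> (t%:E < T)%E.
  by move=> ttau; apply: le_lt_trans tauT; rewrite lee_fin.
have xv t : 0 <= t <= tau -> velocity x t (sfield f g zeta (x t)).
  by move=> /andP[t0 /tT tT1]; exact: solution_velocity sol t0 tT1.
have [//|s /andP[s0 stau]] := velocity_MVT (phi := f) (lexx 0) tau0 xv.
rewrite subr0 x00 diff_grad// => fE.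
have [f0 g0 _] := sol.2 s (ltW s0) (tT s (ltW stau)).
have D := dot_sfield z0 f0 g0.
have := cP s (ltW s0) (ltW stau).
have z10 : 0 <= 1 - zeta by lra.
move=> /(ler_wpM2l z10) C.
have : (1 - zeta) * c * tau <=
    - dot (grad f (x s)) (sfield f g zeta (x s)) * tau.
  by rewrite ler_pM2r//; lra.
by rewrite mulNr -fE; lra.
Qed.

Lemma solution_comp_continuous (R : realType) n (f g phi : 'rV[R]_n -> R)
    zeta x0 T x (t : R) :
  continuous phi -> is_solution f g zeta x0 T x -> (t%:E < T)%E ->
  {within `[0, t], continuous (phi \o x)}.
Proof.
move=> cphi sol tT.
apply: (velocity_comp_continuous (v := fun s => sfield f g zeta (x s))) => //.
  move=> s /andP[s0 st]; apply: solution_velocity sol s0 _.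
  by apply: le_lt_trans tT; rewrite lee_fin.
by move=> s _; exact: cphi.
Qed.

(** The infimum of the zeros is a zero by continuity, and before it [phi] cannot
    be nonnegative since the intermediate value theorem would give an earlier
    zero. *)
Lemma first_zero (R : realType) (phi : R -> R) (b : R) :
  0 <= b -> {within `[0, b], continuous phi} -> phi 0 <= 0 -> 0 <= phi b ->
  exists2 tau, 0 <= tau <= b & phi tau = 0 /\
    forall t, 0 <= t -> t < tau -> phi t < 0.
Proof.
move=> b0 cphi p0 pb.
pose A := [set t | 0 <= t <= b /\ phi t = 0].
have A0 : A !=set0.
  have [|c] := @IVT R phi 0 b 0 b0 cphi.
    by rewrite ge_min p0 le_max pb orbT.
  by rewrite in_itv/= => cb pc; exists c.
have Alb : lbound A 0 by move=> t [/andP[]].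
have lA : has_lbound A by exists 0.
have hA : has_inf A by [].
have inf0 : 0 <= inf A by apply: lb_le_inf.
have infb : inf A <= b.
  have [t At] := A0; apply: le_trans (ge_inf lA At) _.
  by case: At => /andP[].
exists (inf A); first by rewrite inf0.
split.
  apply/eqP; rewrite -normr_eq0 eq_le normr_ge0 andbT.
  apply/ler_addgt0Pr => e e0; rewrite add0r.
  have /subspace_continuousP/(_ (inf A)) := cphi.
  rewrite /= in_itv/= inf0 infb => /(_ isT)/cvgrPdist_le/(_ _ e0).
  move=> /nbhs_ballP[d /= d0 dP].
  have [t tA td] := inf_adherent d0 hA.
  have [tb pt] := tA; have := dP t.
  rewrite (_ : from_subspace `[0, b] phi t = 0)// subr0; apply;
    last by rewrite in_itv.
  rewrite /ball /= distrC ger0_norm ?subr_ge0; first by lra.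
  exact: (ge_inf lA).
move=> t t0 ttau; rewrite ltNge; apply/negP => pt.
have tb : t <= b by rewrite (le_trans (ltW ttau)).
have [||c] := @IVT R phi 0 t 0 t0.
- apply: continuous_subspaceW cphi => s /=.
  by rewrite !in_itv/= => /andP[-> /le_trans]; apply.
- by rewrite ge_min p0 le_max pt orbT.
- rewrite in_itv/= => /andP[c0 ct] pc.
  have : inf A <= c.
    by apply: (ge_inf lA); split => //; rewrite c0 (le_trans ct).
  by rewrite leNgt (le_lt_trans ct ttau).
Qed.

Theorem theorem1 (R : realType) (n : nat) (f g : 'rV[R]_n -> R)
    (A1 : coercive f)
    (A2 : forall u, feasible g u -> grad f u != 0)
    (A3 : forall u, feasible g u -> grad g u != 0)
    (A4 : C2 f /\ C2 g)
    (x0 : 'rV[R]_n) (hx0 : feasible g x0) :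
  (forall (zeta : R), 0 <= zeta -> zeta < 1 ->
    forall (T : \bar R) (x : R -> 'rV[R]_n),
      is_maximal_solution f g zeta x0 T x ->
      exists t : R, [/\ 0 <= t, (t%:E < T)%E & ~ feasible g (x t)]) /\
  (exists C : R, forall (zeta : R), 0 <= zeta -> zeta < 1 ->
    forall (T : \bar R) (x : R -> 'rV[R]_n),
      is_maximal_solution f g zeta x0 T x ->
      exists2 tau : R, is_first_hitting_time [set u | g u = 0] T x tau
                     & tau <= C / (1 - zeta)).
Proof.
have [C2f C2g] := A4.
have cf := C2_continuous C2f; have cg := C2_continuous C2g.
have cdf := C2_grad_continuous C2f; have cdg := C2_grad_continuous C2g.
have df : forall u, differentiable f u by case: C2f.
have [c [m [c0 cm]]] := sublevel_bounds A1 cf cg cdf A2 hx0 (lexx (f x0)).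
have below zeta T x : 0 <= zeta -> zeta < 1 -> is_solution f g zeta x0 T x ->
    forall t, 0 <= t -> (t%:E < T)%E -> f (x t) <= f x0.
  move=> z0 z1 sol t t0 tT.
  have := solution_descent (c := 0) df z0 z1 sol t0 tT.
  rewrite mulr0 mul0r subr_ge0; apply=> s _ _; exact: enorm_ge0.
have time_le zeta T x tau : 0 <= zeta -> zeta < 1 ->
    is_solution f g zeta x0 T x ->
    0 <= tau -> (tau%:E < T)%E ->
    (forall t, 0 <= t -> t <= tau -> feasible g (x t)) ->
    tau <= (f x0 - m) / c / (1 - zeta).
  move=> z0 z1 sol tau0 tauT feas.
  have xK t : 0 <= t -> t <= tau -> c <= enorm (grad f (x t)) /\ m <= f (x t).
    move=> t0 ttau; apply: cm; first exact: feas.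
    apply: (below zeta T x) => //.
    by apply: le_lt_trans tauT; rewrite lee_fin.
  have z10 : 0 < 1 - zeta by lra.
  rewrite !ler_pdivlMr//.
  have := solution_descent df z0 z1 sol tau0 tauT
    (fun t t0 tt => (xK t t0 tt).1).
  have := (xK tau tau0 (lexx tau)).2.
  lra.
have exit zeta : 0 <= zeta -> zeta < 1 -> forall T x,
    is_maximal_solution f g zeta x0 T x ->
    exists t : R, [/\ 0 <= t, (t%:E < T)%E & ~ feasible g (x t)].
  move=> z0 z1 T x [T0 sol maxT]; apply: contrapT => noexit.
  have feas t : 0 <= t -> (t%:E < T)%E -> feasible g (x t).
    by move=> t0 tT; apply: contrapT => nf; apply: noexit; exists t.
  (* A finite life time contradicts maximality, an infinite one the time
     bound; [T = -oo] is excluded by [0 < T]. *)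
  case: T T0 sol maxT {noexit} feas => [r|_ sol _ feas|//].
    rewrite lte_fin => r0 sol maxT feas.
    pose K := feasible g `&` [set u | f u <= f x0].
    have cK : compact K by exact: sublevel_compact.
    have xK : (x @ r^'-) K.
      have : \forall t \near r^'-, 0 < t < r.
        by near=> t; apply/andP; split.
      apply: filterS => t /andP[t0 tr].
      split; first by apply: feas; [exact: ltW|rewrite lte_fin].
      by apply: below sol _ _ _; [| |exact: ltW|rewrite lte_fin].
    have [p [[gp _] px]] := cK _ _ xK.
    have [d [d0 [y [ysol yx]]]] :=
      solution_extension z0 z1 r0 cdf cdg sol px (A2 _ gp) (A3 _ gp).
    have : (r + d)%:E = r%:E.
      by apply: (maxT _ y) => //; rewrite lee_fin; lra.
    by case; lra.
  pose tau := Num.max 0 ((f x0 - m) / c / (1 - zeta) + 1).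
  have tau0 : 0 <= tau by rewrite le_max lexx.
  have : tau <= (f x0 - m) / c / (1 - zeta).
    apply: time_le sol tau0 _ _ => //; first exact: ltry.
    by move=> t t0 _; apply: feas => //; exact: ltry.
  by rewrite ge_max => /andP[_]; lra.
split; first by move=> zeta z0 z1 T x; exact: exit.
exists ((f x0 - m) / c) => zeta z0 z1 T x xmax.
have [t1 [t10 t1T /negP]] := exit zeta z0 z1 T x xmax.
rewrite -ltNge => gt1; have [T0 sol _] := xmax.
have [||tau /andP[tau0 taut1] [gtau gneg]] := 
    first_zero t10 (solution_comp_continuous cg sol t1T).
- by rewrite /=; case: sol => ->.
- exact: ltW.
have tauT : (tau%:E < T)%E by apply: le_lt_trans t1T; rewrite lee_fin.
exists tau.
  split => // t t0 tT /= gt; rewrite leNgt; apply/negP => /(gneg _ t0).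
  by rewrite /= gt ltxx.
apply: time_le sol tau0 tauT _ => // t t0.
rewrite le_eqVlt => /predU1P[->|/(gneg _ t0)/ltW//].
by rewrite /feasible /= -gtau.
Unshelve. all: by end_near.
Qed.
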